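(* Let $T$ be a tree with $N \ge 2$ vertices, and let $m$ be the minimum $k \ge 0$ such that $T$ has a $k$-Unbounded Hamiltonian Cycle. Then $m$ equals the number of vertices of $T$ that are not leaves, and $T$ has an $m$-Unbounded Hamiltonian Cycle whose unbounded vertices are exactly the non-leaf vertices of $T$. Moreover, there is an algorithm which, given $T$ by adjacency lists, outputs an $m$-Unbounded Hamiltonian Cycle of $T$ in time $O(N)$.
   Context: A path here means a finite walk, i.e. a finite sequence of vertices $(x_1,\dots,x_\ell)$ with consecutive vertices adjacent; vertices and edges may repeat. A vertex is bounded in such a path if it appears exactly once in the sequence and unbounded if it appears more than once. A $k$-Unbounded Hamiltonian Path is a path in which every vertex of the graph appears and exactly $k$ vertices are unbounded. A $k$-Unbounded Hamiltonian Cycle is a $k$-Unbounded Hamiltonian Path whose first and last vertices $x_1$, $x_\ell$ are adjacent. A leaf of a tree is a vertex of degree $1$. *)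

(* Defs.v *)
From mathcomp Require Import all_boot.

Set Implicit Arguments.
Unset Strict Implicit.
Unset Printing Implicit Defensive.

(* A finite simple graph is a symmetric irreflexive relation on a finType. *)
Section Graphs.

Variables (V : finType) (e : rel V).

Definition simple_graph : Prop := symmetric e /\ irreflexive e.

Definition connected_graph : Prop := forall x y : V, connect e x y.

(* [cycle e c] closes c up, so a graph cycle is a duplicate-free c with at
   least three vertices ([:: x; y] with x, y adjacent also satisfies
   [cycle e] and is not one). *)
Definition acyclic_graph : Prop :=
  forall c : seq V, 2 < size c -> uniq c -> ~~ cycle e c.

Definition is_tree : Prop :=
  [/\ simple_graph, 0 < #|V|, connected_graph & acyclic_graph].

Definition degree (v : V) : nat := #|[set w | e v w]|.

Definition leaf (v : V) : bool := degree v == 1.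

Definition nonleaves : {set V} := [set v | ~~ leaf v].

Definition is_walk (s : seq V) : Prop := s != [::] /\ sorted e s.

Definition unbounded (s : seq V) : {set V} := [set v | 1 < count_mem v s].

Definition is_UHP (k : nat) (s : seq V) : Prop :=
  [/\ is_walk s, forall v : V, v \in s & #|unbounded s| = k].

Definition ends_adjacent (s : seq V) : bool :=
  if s is x :: p then e x (last x p) else false.

(* The closing step from the last vertex back to the first one is not part of
   the sequence and so does not count towards multiplicities. *)
Definition is_UHC (k : nat) (s : seq V) : Prop :=
  is_UHP k s /\ ends_adjacent s.

Definition is_min_UHC (m : nat) : Prop :=
  (exists s : seq V, is_UHC m s) /\
  (forall (k : nat) (s : seq V), is_UHC k s -> m <= k).

End Graphs.

(* Word RAM: registers and memory are indexed by nat and hold naturals, every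
   instruction costs one step, and the only arithmetic is addition and
   truncated subtraction.  [W] is the largest representable word: an
   instruction that would put a larger value in a register fails.  For inputs
   of size O(N) the usual O(log N)-bit words amount to W = O(N) here. *)
Inductive instr : Type :=
| IConst of nat & nat          (* IConst r n     : r := n                 *)
| IMove of nat & nat           (* IMove r a      : r := a                 *)
| IAdd of nat & nat & nat      (* IAdd r a b     : r := a + b             *)
| ISub of nat & nat & nat      (* ISub r a b     : r := a - b (truncated) *)
| IRead of nat & nat           (* IRead r a      : r := memory[a]         *)
| IWrite of nat & nat          (* IWrite a b     : memory[a] := b         *)
| IJump of nat                 (* IJump l        : go to l                *)
| IJumpEq of nat & nat & nat   (* IJumpEq a b l  : if a = b then go to l  *)
| IHalt.

Definition program : Type := seq instr.

Record state : Type :=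
  State { pc : nat; reg : nat -> nat; memory : nat -> nat }.

Definition upd (f : nat -> nat) (i x : nat) : nat -> nat :=
  fun j => if j == i then x else f j.

Definition set_reg (W : nat) (st : state) (r x : nat) : option state :=
  if x <= W then Some (State (pc st).+1 (upd (reg st) r x) (memory st))
  else None.

Definition step (W : nat) (i : instr) (st : state) : option state :=
  match i with
  | IConst r n => set_reg W st r n
  | IMove r a => set_reg W st r (reg st a)
  | IAdd r a b => set_reg W st r (reg st a + reg st b)
  | ISub r a b => set_reg W st r (reg st a - reg st b)
  | IRead r a => set_reg W st r (memory st (reg st a))
  | IWrite a b =>
      Some (State (pc st).+1 (reg st) (upd (memory st) (reg st a) (reg st b)))
  | IJump l => Some (State l (reg st) (memory st))
  | IJumpEq a b l =>
      Some (State (if reg st a == reg st b then l else (pc st).+1)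
                  (reg st) (memory st))
  | IHalt => Some st
  end.

(* [Some] of the halting state if P halts within t steps, [None] otherwise.
   Running past the end of the program counts as halting. *)
Fixpoint run (P : program) (W t : nat) (st : state) : option state :=
  let i := nth IHalt P (pc st) in
  if i is IHalt then Some st
  else if t is t'.+1 then obind (run P W t') (step W i st) else None.

(* The input occupies the memory from address 0 on; all other cells and all
   registers are 0. *)
Definition init_state (input : seq nat) : state :=
  State 0 (fun=> 0) (nth 0 input).

(* On halting, register 0 holds the address and register 1 the length of the
   output block. *)
Definition output (st : state) : seq nat :=
  [seq memory st (reg st 0 + i) | i <- iota 0 (reg st 1)].

Definition computes (P : program) (W t : nat) (input out : seq nat) : Prop :=
  omap output (run P W t (init_state input)) = Some out.

(* The neighbours may be listed in any order. *)
Definition adjacency_lists (N : nat) (e : rel 'I_N)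
    (adj : 'I_N -> seq 'I_N) : Prop :=
  forall v : 'I_N, uniq (adj v) /\ (forall w : 'I_N, (w \in adj v) = e v w).

(* Memory layout of lists l_0, ..., l_(N-1):
     N, a_0, ..., a_(N-1), block_0, ..., block_(N-1)
   where block_v is the length of l_v followed by its entries, and a_v is the
   address of block_v. *)
Definition encode_lists (ls : seq (seq nat)) : seq nat :=
  let blocks := [seq size l :: l | l <- ls] in
  size ls ::
    [seq (size ls).+1 + sumn (shape (take v blocks)) | v <- iota 0 (size ls)]
    ++ flatten blocks.

Definition encode_adj (N : nat) (adj : 'I_N -> seq 'I_N) : seq nat :=
  encode_lists [seq map val (adj v) | v <- enum 'I_N].

(* Main.v *)
Require Import Defs.
From mathcomp Require Import all_boot.
From mathcomp Require Import zify.

Set Implicit Arguments.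
Unset Strict Implicit.
Unset Printing Implicit Defensive.

(* Every edge of a tree is a bridge.  Lower bound: a closed walk visiting a
   non-leaf v only once would connect two neighbours of v while avoiding v, so
   every non-leaf is unbounded in every Unbounded Hamiltonian Cycle.  Upper
   bound: root the tree at r and take the Euler tour, in which a vertex occurs
   once more than it has children; dropping the final return to r leaves each
   leaf with one occurrence (including r, when r is a leaf) and keeps the two
   ends adjacent.  The RAM program computes this tour by depth-first search,
   keeping in memory only the parent and the number of unexamined neighbours
   of each vertex; each of the at most 2N output entries costs O(1) steps. *)

(** * Trees *)

Section Bridges.

Variables (V : finType) (e : rel V).
Hypotheses (e_simple : simple_graph e) (e_acyclic : acyclic_graph e).

Let e_sym : symmetric e := e_simple.1.
Let e_irr : irreflexive e := e_simple.2.

Definition del_edge (x y : V) : rel V :=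
  [rel u w | e u w && ~~ ((u == x) && (w == y) || (u == y) && (w == x))].

Lemma del_edge_sym x y : symmetric (del_edge x y).
Proof.
move=> u w; rewrite /del_edge /= e_sym orbC.
by rewrite [(w == x) && _]andbC [(w == y) && _]andbC.

Qed.

(** A duplicate-free path from [x] to [y] avoiding the edge, closed up by the edge itself, would be
    a cycle. *)
Lemma acyclic_bridge x y : e x y -> ~~ connect (del_edge x y) x y.
Proof.
move=> exy; apply/negP => /connectP[p0 p0P lastp0].
case: (shortenP p0P) lastp0 => p pP p_uniq _ lastp {p0 p0P}.
have e_p : path e x p by apply: sub_path pP => u w /andP[].
(* Length 0 would make [x] a neighbour of itself, and length 1 would be the deleted edge. *)
have size_p : 2 < size (x :: p).
  case: p pP p_uniq lastp {e_p} => [|z [|//]] /=.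
    by move=> _ _ yx; move: exy; rewrite yx e_irr.
  by move=> zP _ yz; move: zP; rewrite /del_edge /= yz !eqxx /= andbF.
move/negP: (e_acyclic size_p p_uniq); apply.
by rewrite /= rcons_path e_p -lastp e_sym.
Qed.

Lemma degree_gt0 v : connected_graph e -> 1 < #|V| -> 0 < degree e v.
Proof.
move=> conn /card_gt1P[x [y [_ _ xy]]].
have [w wv] : exists w, w != v.
  by case: (eqVneq x v) xy => [<-|]; [exists y; rewrite eq_sym | exists x].
case/connectP: (conn v w) => [[|z p]] /=.
  by move=> _ Dw; rewrite Dw eqxx in wv.
by case/andP=> ez _ _; apply/card_gt0P; exists z; rewrite inE.
Qed.

(** Allows the sequence to be rotated so that it starts at any chosen vertex. *)
Lemma UHC_cycle k s : is_UHC e k s -> cycle e s.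
Proof.
case=> [[[_ s_sorted] _ _]]; case: s s_sorted => //= x p xp elast.
by rewrite rcons_path xp e_sym.
Qed.

(* If v occurred only once, the rest of the closed walk would join two
   neighbours of v without using v, although edges of T are bridges. *)
Lemma nonleaves_sub_unbounded k s :
  connected_graph e -> 1 < #|V| -> is_UHC e k s ->
  nonleaves e \subset unbounded s.
Proof.
move=> conn V2 sP; have s_cycle := UHC_cycle sP.
case: (sP) => [[_ s_all _] _]; apply/subsetP => v; rewrite !inE /leaf => deg_v.
rewrite ltnNge; apply/negP => v_once.
have /card_gt1P[w1 [w2 []]] : 1 < degree e v.
  by move: (degree_gt0 v conn V2) deg_v; case: (degree e v) => [|[]].
rewrite !inE => ew1 ew2 w12.
case: (rot_to (s_all v)) => i q Dq.
have v_q : v \notin q.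
  have /permP/(_ (pred1 v)) : perm_eq (v :: q) s by rewrite -Dq perm_rot.
  move=> Dc; move: v_once; rewrite -Dc /= eqxx -has_pred1 has_count.
  by rewrite ltnS leqn0 lt0n => /eqP->.
have in_q w : e v w -> w \in q.
  move=> ew; have: w \in v :: q by rewrite -Dq mem_rot.
  by rewrite inE => /predU1P[wv|//]; move: ew; rewrite wv e_irr.
have: cycle e (v :: q) by rewrite -Dq rot_cycle.
rewrite /= rcons_path => /andP[q_path _].
(* The walk [q] never meets [v], so deleting an edge at [v] leaves all its steps intact. *)
have q_conn : {in q &, forall x y, connect (del_edge v w1) x y}.
  case: q v_q q_path {Dq in_q} => //= z q; rewrite inE negb_or => /andP[vz v_q].
  case/andP=> _ zq.
  have {}zq : path (del_edge v w1) z q.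
    elim: q z zq v_q vz => //= t q IHq z /andP[ezt tq]; rewrite inE negb_or.
    case/andP=> vt v_q vz; rewrite (IHq t) // andbT /del_edge /= ezt /=.
    by rewrite ![_ == v]eq_sym (negPf vt) (negPf vz) andbF.
  have z_conn x : x \in z :: q -> connect (del_edge v w1) z x.
    move=> xq; case/splitPl: xq zq => p1 p2 lx; rewrite cat_path => /andP[zp1 _].
    by apply/connectP; exists p1.
  move=> x y xq yq; apply: (@connect_trans _ _ z); last exact: z_conn.
  by rewrite (sym_connect_sym (del_edge_sym v w1)) z_conn.
move/negP: (acyclic_bridge ew1); apply.
(* Go from [v] to [w2] by a surviving edge, then from [w2] to [w1] inside [q]. *)
apply: (@connect_trans _ _ w2); last by apply: q_conn; apply: in_q.
have w2v : w2 != v by apply: contraTneq ew2 => ->; rewrite e_irr.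
apply: connect1; rewrite /del_edge /= ew2 eqxx /= [w2 == w1]eq_sym (negPf w12).
by rewrite (negPf w2v) andbF.
Qed.

Lemma UHC_ge k s :
  connected_graph e -> 1 < #|V| -> is_UHC e k s -> #|nonleaves e| <= k.
Proof.
move=> conn V2 sP; case: (sP) => [[_ _ <-] _].
exact/subset_leq_card/(nonleaves_sub_unbounded conn V2 sP).
Qed.

End Bridges.

(** * Rooted trees: parents and depths *)

(** The root is its own parent, which keeps [par] total. Only differences of [dep] are constrained,
    hence later depth bounds are relative to the depth of a starting vertex. *)
Record rooting (V : finType) (e : rel V) (r : V) (par : V -> V) (dep : V -> nat)
  : Prop := Rooting {
  par_root : par r = r;
  dep_par : forall v, v != r -> dep v = (dep (par v)).+1;
  par_adj : forall v, v != r -> e v (par v);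
  edge_par : forall x y, e x y -> par x = y \/ par y = x }.

(** Depth is the distance from [r], and the parent is a neighbour one step closer. Were an edge not
    a parent edge either way, climbing from both its ends to [r] would bypass it, although it is a
    bridge. *)
Lemma tree_rooting (V : finType) (e : rel V) (r : V) :
  is_tree e -> exists par dep, rooting e r par dep.
Proof.
case=> simple _ conn acyclic.
(* Tuples of fixed length form a finite type, so this is a boolean and [ex_minn] applies. *)
pose reach v n := [exists t : n.-tuple V, path e r t && (last r t == v)].
have reach_ex v : exists n, reach v n.
  case/connectP: (conn r v) => p rp lastp; exists (size p); apply/existsP.
  by exists (in_tuple p); rewrite rp lastp eqxx.
pose dep v := ex_minn (reach_ex v).
have dep_le v p : path e r p -> last r p = v -> dep v <= size p.
  move=> rp lastp; rewrite /dep; case: ex_minnP => n _; apply; apply/existsP.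
  by exists (in_tuple p); rewrite rp lastp eqxx.
have par_ex v : v != r -> exists u, e v u && (dep v == (dep u).+1).
  move=> v_r; rewrite {1}/dep; case: ex_minnP => n /existsP[t].
  case/andP=> rt /eqP lastt min_n.
  have size_t := size_tuple t.
  case/lastP: (tval t) rt lastt size_t => [|p w] /=.
    by move=> _ Dv; rewrite Dv eqxx in v_r.
  rewrite rcons_path last_rcons size_rcons => /andP[rp ew] wv size_p.
  subst w; exists (last r p); rewrite simple.1 ew eqn_leq -size_p !ltnS.
  rewrite andTb andbC dep_le //=.
  (* A shorter path to the predecessor would extend to a shorter one to [v]. *)
  rewrite /dep; case: ex_minnP => k /existsP[q /andP[rq /eqP lastq]] _.
  rewrite -ltnS size_p; apply: min_n; apply/existsP; exists (rcons_tuple q v).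
  by rewrite /= rcons_path rq lastq ew last_rcons /=.
(* With the guard the existence holds for every vertex, as [xchoose] demands. *)
have par_ex' v : exists u, (v != r) ==> e v u && (dep v == (dep u).+1).
  by case: (eqVneq v r) => [->|/par_ex //]; exists r.
pose par v := if v == r then r else xchoose (par_ex' v).
have parP v : v != r -> e v (par v) && (dep v == (dep (par v)).+1).
  move=> vr; rewrite /par ifN //.
  exact: implyP (xchooseP (par_ex' v)) vr.
exists par, dep; split.
- by rewrite /par ifT.
- by move=> v /parP/andP[_ /eqP].
- by move=> v /parP/andP[].
move=> x y exy; case: (eqVneq (par x) y) => [|xy]; first by left.
case: (eqVneq (par y) x) => [|yx]; first by right.
(* Each climbing step is a parent edge, hence different from the edge between [x] and [y]. *)
have to_root v : connect (del_edge e x y) v r.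
  elim: {v}(dep v) {-2}v (erefl (dep v)) => [|n IHn] v Dv.
    case: (eqVneq v r) => [-> //|/parP/andP[_]]; by rewrite Dv.
  case: (eqVneq v r) => [-> //|/parP/andP[ev /eqP]]; rewrite Dv => -[Dn].
  apply: (connect_trans (connect1 _) (IHn (par v) (esym Dn))).
  rewrite /del_edge /= ev /=; apply/negP => /orP[] /andP[/eqP-> /eqP Dpar].
    by rewrite Dpar eqxx in xy.
  by rewrite Dpar eqxx in yx.
move/negP: (acyclic_bridge simple acyclic exy); case.
apply: (connect_trans (to_root x)).
by rewrite (sym_connect_sym (del_edge_sym simple x y)).
Qed.

(** * Euler tours *)

Lemma size_sum_count (T : finType) (s : seq T) :
  size s = \sum_(x : T) count_mem x s.
Proof.
elim: s => [|y s IHs] /=; first by rewrite big1.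
rewrite big_split /= -IHs (bigD1 y) //= eqxx big1 // => x.
by rewrite eq_sym => /negPf->.
Qed.

Section Tour.

Variables (V : finType) (e : rel V) (r : V) (par : V -> V) (dep : V -> nat).
(** The order of the children is left open: the existence proof takes that of [enum V], the program
    that of its adjacency lists. *)
Variable children : V -> seq V.
Hypotheses (e_simple : simple_graph e) (rooted : rooting e r par dep).
Hypothesis children_uniq : forall v, uniq (children v).
Hypothesis childrenE : forall v w, (w \in children v) = e v w && (par w == v).

Lemma child_neq_root v w : w \in children v -> w != r.
Proof.
rewrite childrenE => /andP[evw /eqP pw]; apply: contraTneq evw => wr.
by move: pw; rewrite wr (par_root rooted) => ->; rewrite e_simple.2.
Qed.

Lemma child_par v w : w \in children v -> par w = v.
Proof. by rewrite childrenE => /andP[_ /eqP]. Qed.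

Lemma child_dep v w : w \in children v -> dep w = (dep v).+1.
Proof.
by move=> w_v; rewrite (dep_par rooted (child_neq_root w_v)) (child_par w_v).
Qed.

(** Euler tour cut off [n] levels below [v]; it is complete once [n] reaches the height of the
    subtree. [v] is repeated after each child, so the final return is included. *)
Fixpoint tour (n : nat) (v : V) : seq V :=
  if n is n'.+1 then
    v :: flatten [seq rcons (tour n' w) v | w <- children v]
  else [:: v].

Lemma tourS n v :
  tour n.+1 v = v :: flatten [seq rcons (tour n w) v | w <- children v].
Proof. by []. Qed.

Lemma tour_cons n v : tour n v = v :: behead (tour n v).
Proof. by case: n. Qed.

(** Places the tour inside the subtree of [v]: the ancestor of [u] at the depth of [v] is [v].
    Disjointness of subtrees follows from this. *)
Lemma tour_par_iter n v u :
  u \in tour n v -> dep v <= dep u /\ iter (dep u - dep v) par u = v.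
Proof.
elim: n v => [|n IHn] v; rewrite ?tourS inE; first by move/eqP->; rewrite subnn.
case/predU1P => [->|/flatten_mapP[w w_v]]; first by rewrite subnn.
rewrite mem_rcons inE => /predU1P[->|/IHn]; first by rewrite subnn.
rewrite (child_dep w_v) => -[dvu itu]; split; first exact: ltnW.
by rewrite -(subnSK dvu) iterS itu (child_par w_v).
Qed.

Lemma parent_notin_tour n v w : w \in children v -> v \notin tour n w.
Proof.
by move=> w_v; apply/negP => /tour_par_iter[]; rewrite (child_dep w_v) ltnn.
Qed.

Lemma tour_siblings_disjoint n v w1 w2 u :
  w1 \in children v -> w2 \in children v ->
  u \in tour n w1 -> u \in tour n w2 -> w1 = w2.
Proof.
move=> /child_dep d1 /child_dep d2 /tour_par_iter[_ <-] /tour_par_iter[_ <-].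
by rewrite d1 d2.
Qed.

(** The depth bound says that enough fuel is left to expand [u]. *)
Lemma child_in_tour n v u w :
  u \in tour n v -> w \in children u -> dep w <= dep v + n -> w \in tour n v.
Proof.
move=> + w_u; elim: n v => [|n IHn] v.
  by rewrite inE => /eqP <-; rewrite (child_dep w_u) addn0 ltnn.
rewrite !tourS !inE => u_v dep_w; apply/orP; right.
case/predU1P: u_v => [uv|/flatten_mapP[x x_v]].
  apply/flatten_mapP; exists w; first by rewrite -uv.
  by rewrite mem_rcons inE tour_cons mem_head orbT.
rewrite mem_rcons inE => /predU1P[uv|u_x]; apply/flatten_mapP.
  exists w; first by rewrite -uv.
  by rewrite mem_rcons inE tour_cons mem_head orbT.
exists x => //; rewrite mem_rcons inE IHn ?orbT //.
by rewrite (child_dep x_v) addSnnS.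
Qed.

(** Induction on depth: once the parent of [u] is in the tour, so is [u]. *)
Lemma mem_tour n u : dep u <= dep r + n -> u \in tour n r.
Proof.
elim: {u}(dep u) {-2}u (erefl (dep u)) => [|d IHd] u Du dep_u;
  (have [->|ur] := eqVneq u r; first by rewrite tour_cons mem_head).
  by rewrite (dep_par rooted ur) in Du.
have Dp : dep (par u) = d by move: Du; rewrite (dep_par rooted ur) => -[].
apply: (@child_in_tour n r (par u)) => //; first by apply: IHd => //; lia.
by rewrite childrenE eqxx e_simple.1 (par_adj rooted).
Qed.

(** Generalised from all children to any list [ws] of them, to allow induction on [ws]. *)
Lemma path_tour_aux n v (ws : seq V) :
  (forall w, path e w (behead (tour n w)) /\ last w (behead (tour n w)) = w) ->
  {subset ws <= children v} ->
  let p := flatten [seq rcons (tour n w) v | w <- ws] in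
  path e v p /\ last v p = v.
Proof.
move=> IHn; elim: ws => [|w ws IHws] //= ws_v.
have w_v : w \in children v by apply: ws_v; rewrite mem_head.
have [] := IHws (fun u u_ws => ws_v u (mem_behead (s := w :: ws) u_ws)).
move=> pathp lastp; have [path_w last_w] := IHn w.
move: w_v; rewrite childrenE => /andP[evw _].
rewrite cat_path last_cat last_rcons rcons_path tour_cons /= path_w last_w.
by rewrite [e w v]e_simple.1 evw pathp lastp.
Qed.

Lemma path_tour n v :
  path e v (behead (tour n v)) /\ last v (behead (tour n v)) = v.
Proof. by elim: n v => [|n IHn] v //; apply: path_tour_aux. Qed.

(** A vertex occurs on entry and after each child. A cut-off tour may stop earlier, hence an
    inequality. *)
Lemma count_tour n v u : count_mem u (tour n v) <= (size (children u)).+1.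
Proof.
elim: n v => [|n IHn] v; first by rewrite /=; case: eqP.
rewrite tourS /= count_flatten -map_comp.
case: (eqVneq v u) => [->|vu] /=.
  (* At the top vertex, each child contributes only the return. *)
  suff: forall ws, {subset ws <= children u} ->
      sumn [seq count_mem u (rcons (tour n w) u) | w <- ws] <= size ws.
    by rewrite add1n ltnS; apply.
  elim=> [|w ws IHws] //= ws_u.
  have w_u : w \in children u by apply: ws_u; rewrite mem_head.
  have := IHws (fun x x_ws => ws_u x (mem_behead (s := w :: ws) x_ws)).
  have := parent_notin_tour n w_u; rewrite -has_pred1 has_count -leqNgt leqn0.
  by move/eqP => c0; rewrite -cats1 count_cat c0 /= eqxx add0n addn0 add1n ltnS.
suff: forall ws, uniq ws -> {subset ws <= children v} ->
    sumn [seq count_mem u (rcons (tour n w) v) | w <- ws]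
      <= (size (children u)).+1.
  by rewrite add0n; apply.
elim=> [|w ws IHws] //= /andP[w_ws ws_uniq] ws_v.
have w_v : w \in children v by apply: ws_v; rewrite mem_head.
have {}ws_v : {subset ws <= children v}.
  by move=> x x_ws; rewrite ws_v // inE x_ws orbT.
rewrite -cats1 count_cat /= (negPf vu) !addn0.
(* If [u] lies below [w], the other siblings contribute nothing. *)
case: (boolP (u \in tour n w)) => [u_w|u_w].
  rewrite sumnE big_map big_seq big1 ?addn0 // => x x_ws /=.
  rewrite -cats1 count_cat /= (negPf vu) !addn0; apply/count_memPn.
  apply: contraL u_w => u_x; apply: contraNN w_ws => u_w.
  by rewrite (tour_siblings_disjoint w_v (ws_v _ x_ws) u_w u_x).
by rewrite (count_memPn u_w) IHws.
Qed.

(** Vertices are grouped by parent. Only the root is lost, being its own parent but not its own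
    child. *)
Lemma sum_children : \sum_v size (children v) <= #|V|.
Proof.
rewrite -sum1_card [X in _ <= X](partition_big par xpredT) //=; apply: leq_sum => v _.
rewrite sum1dep_card -(card_uniqP (children_uniq v)); apply/subset_leq_card/subsetP.
by move=> w /child_par pw; rewrite inE pw.
Qed.

Lemma size_tour n v : size (tour n v) <= 2 * #|V|.
Proof.
rewrite size_sum_count (@leq_trans (\sum_v (1 + size (children v)))) //.
  by apply: leq_sum => u _; apply: count_tour.
by rewrite big_split /= sum1_card mul2n -addnn leq_add2l sum_children.
Qed.

(** The single neighbour of a leaf is its parent, unless the leaf is the root, whose neighbours are
    all children. *)
Lemma size_children_leaf v : leaf e v -> size (children v) = (v == r).
Proof.
rewrite /leaf /degree => /eqP deg_v.
have children_e : {subset children v <= [set w | e v w]}.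
  by move=> w; rewrite childrenE inE => /andP[].
case: eqP => [vr|/eqP vr].
  apply/eqP; rewrite -[nat_of_bool _]/1 -deg_v eqn_leq.
  rewrite -(card_uniqP (children_uniq v)).
  apply/andP; split; first exact/subset_leq_card/subsetP.
  apply/subset_leq_card/subsetP => w; rewrite inE childrenE => evw; rewrite evw /=.
  case: (edge_par rooted evw) => [|->//]; rewrite vr (par_root rooted) => rw.
  by move: evw; rewrite vr -rw e_simple.2.
(* By depth the parent is not a child, so parent and children are distinct neighbours. *)
have: uniq (par v :: children v).
  rewrite /= children_uniq andbT; apply/negP => /child_dep.
  by rewrite (dep_par rooted vr); lia.
move/card_uniqP => /= card_v; apply/eqP; rewrite -leqn0 -ltnS -card_v -deg_v.
apply/subset_leq_card/subsetP => w; rewrite !inE => /predU1P[->|/children_e].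
  exact: (par_adj rooted).
by rewrite inE.
Qed.

(** Counting shows that leaves occur once; that non-leaves repeat comes from the lower bound applied
    to this very cycle. *)
Lemma open_tour_UHC n :
  connected_graph e -> acyclic_graph e -> 1 < #|V| ->
  (forall u, dep u <= dep r + n) ->
  let s := take (size (tour n r)).-1 (tour n r) in
  is_UHC e #|nonleaves e| s /\ unbounded s = nonleaves e.
Proof.
move=> conn acyclic V2 dep_n /=.
have [path_r last_r] := path_tour n r.
have r_all u : u \in tour n r by apply: mem_tour.
have tour_count u : count_mem u (tour n r) <= (size (children u)).+1.
  exact: count_tour.
move: (tour_cons n r) path_r last_r => Dt; rewrite {}Dt in r_all tour_count *.
(* With two vertices to visit, the tour is not just [r]; it has the form [r :: rcons p r]. *)
case/lastP: (behead _) r_all tour_count => [|p x] r_all tour_count path_r last_r.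
  have [y [z [_ _]]] := card_gt1P V2.
  by move: (r_all y) (r_all z); rewrite !inE => /eqP-> /eqP->; rewrite eqxx.
rewrite last_rcons in last_r; rewrite {}last_r in path_r r_all tour_count *.
have -> : take (size (r :: rcons p r)).-1 (r :: rcons p r) = r :: p.
  by rewrite /= size_rcons /= -cats1 take_size_cat.
move: (path_r); rewrite rcons_path => /andP[path_p e_last].
have p_all u : u \in r :: p.
  by move: (r_all u); rewrite !inE mem_rcons inE orbA orbb.
(* For a leaf the count in the full tour is at most 1, or 2 at the root, where the dropped return
   removes one. *)
have ub : unbounded (r :: p) \subset nonleaves e.
  apply/subsetP => u; rewrite !inE; apply: contraTN => leaf_u.
  move: (tour_count u); rewrite -rcons_cons -cats1 count_cat -leqNgt.
  by rewrite (size_children_leaf leaf_u) [u == r]eq_sym /=; case: (r == u); lia.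
have adj_ends : ends_adjacent e (r :: p) by rewrite /= e_simple.1.
have UHP_p : is_UHP e #|unbounded (r :: p)| (r :: p) by split.
have UHC_p : is_UHC e #|unbounded (r :: p)| (r :: p) by split.
have eq_ub : unbounded (r :: p) = nonleaves e.
  apply/eqP; rewrite eqEsubset ub.
  exact: (nonleaves_sub_unbounded e_simple acyclic conn V2 UHC_p).
by rewrite -eq_ub.
Qed.

End Tour.

(** * The value of the minimum *)

(** Identifies any given minimal [m] with the number of non-leaves in the algorithmic half. *)
Lemma min_UHC_unique (V : finType) (e : rel V) m m' :
  is_min_UHC e m -> is_min_UHC e m' -> m = m'.
Proof.
case=> -[s sP] min_m [[s' s'P] min_m']; apply/eqP.
by rewrite eqn_leq (min_m _ _ s'P) (min_m' _ _ sP).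
Qed.

Lemma tree_min_UHC (V : finType) (e : rel V) :
  is_tree e -> 1 < #|V| ->
  is_min_UHC e #|nonleaves e| /\
  exists s, is_UHC e #|nonleaves e| s /\ unbounded s = nonleaves e.
Proof.
move=> tree V2; have [simple /card_gt0P[r _] conn acyclic] := tree.
have [par [dep rooted]] := tree_rooting r tree.
pose children v := [seq w <- enum V | e v w && (par w == v)].
have [] := @open_tour_UHC V e r par dep children simple rooted _ _
  (\max_u dep u) conn acyclic V2.
- by move=> v; rewrite filter_uniq // enum_uniq.
- by move=> v w; rewrite mem_filter mem_enum andbT.
- by move=> u; apply: leq_trans (leq_addl _ _); apply: (leq_bigmax u).
move=> UHC_s Ds; split; last by eexists; split; [apply: UHC_s | apply: Ds].
by split; [eexists; apply: UHC_s | move=> k s; apply: UHC_ge].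
Qed.

(** * The depth-first search program *)

Section Execution.

Variables (P : program) (W : nat).

(** Leaving the remaining fuel [t] arbitrary makes executions compose by adding their lengths. *)
Definition steps (n : nat) (st st' : state) : Prop :=
  forall t, run P W (n + t) st = run P W t st'.

Lemma steps_trans m n st1 st2 st3 :
  steps m st1 st2 -> steps n st2 st3 -> steps (m + n) st1 st3.
Proof. by move=> s12 s23 t; rewrite -addnA s12 s23. Qed.

(** [IHalt] is excluded because [run] stops there without consuming fuel. *)
Lemma steps_step n pc rg mem st st' :
  (if nth IHalt P pc is IHalt then false else true) ->
  step W (nth IHalt P pc) (State pc rg mem) = Some st ->
  steps n st st' -> steps n.+1 (State pc rg mem) st'.
Proof.
by move=> + step_st st_st' t; rewrite addSn /= step_st -st_st'; case: nth.
Qed.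

Variables (n pc : nat) (rg mem : nat -> nat) (st : state).

Lemma steps_const r x :
  nth IHalt P pc = IConst r x -> x <= W ->
  steps n (State pc.+1 (upd rg r x) mem) st -> steps n.+1 (State pc rg mem) st.
Proof. by move=> Pi xW; apply: steps_step; rewrite Pi //= /set_reg /= xW. Qed.

Lemma steps_move r a x :
  nth IHalt P pc = IMove r a -> rg a = x -> x <= W ->
  steps n (State pc.+1 (upd rg r x) mem) st -> steps n.+1 (State pc rg mem) st.
Proof. by move=> Pi <- xW; apply: steps_step; rewrite Pi //= /set_reg /= xW. Qed.

Lemma steps_add r a b x :
  nth IHalt P pc = IAdd r a b -> rg a + rg b = x -> x <= W ->
  steps n (State pc.+1 (upd rg r x) mem) st -> steps n.+1 (State pc rg mem) st.
Proof. by move=> Pi <- xW; apply: steps_step; rewrite Pi //= /set_reg /= xW. Qed.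

Lemma steps_sub r a b x :
  nth IHalt P pc = ISub r a b -> rg a - rg b = x -> x <= W ->
  steps n (State pc.+1 (upd rg r x) mem) st -> steps n.+1 (State pc rg mem) st.
Proof. by move=> Pi <- xW; apply: steps_step; rewrite Pi //= /set_reg /= xW. Qed.

Lemma steps_read r a x :
  nth IHalt P pc = IRead r a -> mem (rg a) = x -> x <= W ->
  steps n (State pc.+1 (upd rg r x) mem) st -> steps n.+1 (State pc rg mem) st.
Proof. by move=> Pi <- xW; apply: steps_step; rewrite Pi //= /set_reg /= xW. Qed.

Lemma steps_write a b x y :
  nth IHalt P pc = IWrite a b -> rg a = x -> rg b = y ->
  steps n (State pc.+1 rg (upd mem x y)) st -> steps n.+1 (State pc rg mem) st.
Proof. by move=> Pi <- <-; apply: steps_step; rewrite Pi. Qed.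

Lemma steps_jump_eq a b l :
  nth IHalt P pc = IJumpEq a b l -> rg a = rg b ->
  steps n (State l rg mem) st -> steps n.+1 (State pc rg mem) st.
Proof. by move=> Pi ab; apply: steps_step; rewrite Pi //= ab eqxx. Qed.

Lemma steps_jump_neq a b l :
  nth IHalt P pc = IJumpEq a b l -> rg a <> rg b ->
  steps n (State pc.+1 rg mem) st -> steps n.+1 (State pc rg mem) st.
Proof. by move=> Pi /eqP/negPf ab; apply: steps_step; rewrite Pi //= ab. Qed.

End Execution.

Definition dfs_program : program :=
  [:: IRead 5 4; IConst 3 1; IAdd 6 5 5; IAdd 6 6 6; IAdd 6 6 5; IAdd 0 6 5;
      IWrite 6 5;
      (* 7: append vertex r2 to the output *)
      IAdd 7 0 1; IWrite 7 2; IAdd 1 1 3;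
      (* 10: take the last remaining neighbour r10 of r2 *)
      IAdd 7 2 3; IRead 8 7; IRead 9 8; IJumpEq 9 4 25;
      IAdd 10 8 9; IRead 10 10; ISub 9 9 3; IWrite 8 9;
      IAdd 7 6 2; IRead 7 7; IJumpEq 7 10 10;
      IAdd 7 6 10; IWrite 7 2; IMove 2 10; IJump 7;
      (* 25: r2 is exhausted, go back to its parent *)
      IAdd 7 6 2; IRead 7 7; IJumpEq 7 5 30; IMove 2 7; IJump 7;
      (* 30: drop the final return to the root *)
      ISub 1 1 3; IHalt].

(** * Correctness and running time of the search *)

Section Dfs.

Variables (N : nat) (e : rel 'I_N) (adj : 'I_N -> seq 'I_N) (r : 'I_N).
Variables (par : 'I_N -> 'I_N) (dep : 'I_N -> nat).
(** The input layout is abstracted to block addresses. The input ends below [5 * N], parents fill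
    the next [N] cells, and an output of at most [2 * N] entries ends by [8 * N]. Only length cells
    of the input are overwritten, so it suffices that these lie outside all other blocks. *)
Variables (addr : 'I_N -> nat) (W : nat).
Hypotheses (e_simple : simple_graph e) (rooted : rooting e r par dep).
Hypothesis adjP : adjacency_lists e adj.
Hypothesis addr_gt : forall u, N < addr u.
Hypothesis addr_lt : forall u, addr u + size (adj u) < 5 * N.
Hypothesis addr_disjoint :
  forall u w i, u != w -> i <= size (adj w) -> addr u <> addr w + i.
Hypothesis W_large : 8 * N < W.

Local Notation run_steps := (steps dfs_program W).

(** Reversed because the program consumes each list from its end. *)
Definition neighbour_children (v : 'I_N) : seq 'I_N :=
  rev [seq w <- adj v | par w == v].

Local Notation children := neighbour_children.
Local Notation tour := (tour children).

Lemma neighbour_children_uniq v : uniq (children v).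
Proof. by rewrite rev_uniq filter_uniq //; case: (adjP v). Qed.

Lemma neighbour_childrenE v w : (w \in children v) = e v w && (par w == v).
Proof. by rewrite mem_rev mem_filter andbC; case: (adjP v) => _ ->. Qed.

(** [N] is no vertex, so it marks the root. *)
Definition parent_word (v : 'I_N) : nat := if v == r then N else par v.

(** Justifies the test made by the program: a neighbour is a child unless it equals the stored
    parent. Depths forbid its being both. *)
Lemma parent_wordE v w : e v w -> (parent_word v == w) = (par w != v).
Proof.
move=> evw; rewrite /parent_word.
have [vr|vr] := eqVneq v r.
  rewrite {}vr in evw *; rewrite gtn_eqF ?ltn_ord //.
  case: (edge_par rooted evw) => [|->]; last by rewrite eqxx.
  by rewrite (par_root rooted) => rw; rewrite -rw e_simple.2 in evw.
rewrite val_eqE; have [pw|pw] := eqVneq (par w) v; last first.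
  by case: (edge_par rooted evw) => [->|/eqP]; rewrite ?eqxx // (negPf pw).
apply/eqP => pv; have wr : w != r.
  by apply: contraNneq vr => wr; rewrite -pw wr (par_root rooted).
by have := dep_par rooted vr; have := dep_par rooted wr; rewrite pw pv; lia.
Qed.

(* Memory during the search: cells u+1 still hold the block addresses, the
   length cell of block u counts the neighbours of u not yet examined (they are
   taken from the end), cell 5N+u holds the parent of u once u is entered, and
   the output grows from 6N on. *)
Record mem_inv (k : 'I_N -> nat) (out : seq 'I_N) (D : pred 'I_N)
    (mem : nat -> nat) : Prop := MemInv {
  mem_addr : forall u : 'I_N, mem u.+1 = addr u;
  mem_count : forall u : 'I_N, mem (addr u) = k u;
  mem_adj : forall (u : 'I_N) i, i < size (adj u) ->
    mem (addr u + i.+1) = nth r (adj u) i;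
  mem_par : forall u : 'I_N, D u -> mem (5 * N + u) = parent_word u;
  mem_out : forall i, i < size out -> mem (6 * N + i) = nth r out i }.

(** Registers 0 to 2 hold the output address, the output length and the current vertex; 3 to 6 hold
    constants. Registers from 7 on are scratch. *)
Record reg_inv (v : 'I_N) (len : nat) (rg : nat -> nat) : Prop := RegInv {
  reg0 : rg 0 = 6 * N;
  reg1 : rg 1 = len;
  reg2 : rg 2 = v;
  reg3 : rg 3 = 1;
  reg4 : rg 4 = 0;
  reg5 : rg 5 = N;
  reg6 : rg 6 = 5 * N }.

Lemma mem_inv_sub k out (D D' : pred 'I_N) mem :
  subpred D' D -> mem_inv k out D mem -> mem_inv k out D' mem.
Proof. by move=> sD [? ? ? mpar ?]; split=> // u /sD/mpar. Qed.

Lemma mem_inv_count k out D mem v j :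
  mem_inv k out D mem ->
  mem_inv [eta k with v |-> j] out D (upd mem (addr v) j).
Proof.
have := addr_lt v; have := addr_gt v.
move=> gtv ltv [ma mc mj mp mo]; split; rewrite /upd.
- move=> u; have := ltn_ord u; case: eqP => [|_]; [lia | by rewrite ma].
- move=> u /=; case: (eqVneq u v) => [->|uv]; first by rewrite eqxx.
  have := addr_disjoint uv (leq0n _); rewrite addn0 => /eqP/negPf->.
  exact: mc.
- move=> u i i_u; case: eqP => [|_]; last exact: mj.
  case: (eqVneq u v) => [->|uv]; first lia.
  by move=> /esym /addr_disjoint-/(_ _ i_u) []; rewrite // eq_sym.
- by move=> u Du; case: eqP => [|_]; [lia | rewrite mp].
- by move=> i iu; case: eqP => [|_]; [lia | rewrite mo].
Qed.

Lemma mem_inv_par k out (D : pred 'I_N) mem w :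
  mem_inv k out D mem ->
  mem_inv k out [predU1 w & D] (upd mem (5 * N + w) (parent_word w)).
Proof.
have w_lt := ltn_ord w.
move=> [ma mc mj mp mo]; split; rewrite /upd.
- move=> u; have := ltn_ord u; case: eqP => [|_]; [lia | by rewrite ma].
- move=> u; have := addr_lt u; case: eqP => [|_]; [lia | by rewrite mc].
- move=> u i i_u; have := addr_lt u; case: eqP => [|_]; [lia | by rewrite mj].
- move=> u; rewrite eqn_add2l /=; case: (eqVneq u w) => [-> _|uw /=].
    by rewrite eqxx.
  by rewrite -val_eqE /= in uw; rewrite (negPf uw) => /mp.
- by move=> i iu; case: eqP => [|_]; [lia | rewrite mo].
Qed.

Lemma mem_inv_emit k out D mem (v : 'I_N) :
  mem_inv k out D mem ->
  mem_inv k (rcons out v) D (upd mem (6 * N + size out) v).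
Proof.
move=> [ma mc mj mp mo]; split; rewrite /upd.
- move=> u; have := ltn_ord u; case: eqP => [|_]; [lia | by rewrite ma].
- move=> u; have := addr_lt u; case: eqP => [|_]; [lia | by rewrite mc].
- move=> u i i_u; have := addr_lt u; case: eqP => [|_]; [lia | by rewrite mj].
- move=> u /mp; have := ltn_ord u; case: eqP => [|_] //; lia.
move=> i; rewrite size_rcons ltnS eqn_add2l nth_rcons leq_eqVlt.
by case: (ltngtP i (size out)) => //= i_out _; rewrite mo.
Qed.

Lemma run_emit k out D rg mem v :
  size out <= 2 * N ->
  reg_inv v (size out) rg -> mem_inv k out D mem ->
  exists rg' mem',
    [/\ run_steps 3 (State 7 rg mem) (State 10 rg' mem'),
        reg_inv v (size (rcons out v)) rg' & mem_inv k (rcons out v) D mem'].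
Proof.
move=> out_le [R0 R1 R2 R3 R4 R5 R6] M; do 2 eexists; split.
- apply: (@steps_add _ _ _ _ _ _ _ 7 0 1 (6 * N + size out)) => //.
  + by rewrite R0 R1.
  + lia.
  apply: (@steps_write _ _ _ _ _ _ _ 7 2 (6 * N + size out) v) => //.
  apply: (@steps_add _ _ _ _ _ _ _ 1 1 3 (size out).+1) => //.
  + by rewrite /upd /= R1 R3 addn1.
  + lia.
- by split; rewrite ?size_rcons.
exact: mem_inv_emit.
Qed.

Lemma run_exhausted k out D rg mem v :
  reg_inv v (size out) rg -> mem_inv k out D mem -> k v = 0 ->
  exists rg',
    run_steps 4 (State 10 rg mem) (State 25 rg' mem) /\
    reg_inv v (size out) rg'.
Proof.
move=> [R0 R1 R2 R3 R4 R5 R6] M kv; eexists; split.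
  have := ltn_ord v; have := addr_lt v => av vN.
  apply: (@steps_add _ _ _ _ _ _ _ 7 2 3 v.+1) => //.
  + by rewrite R2 R3 addn1.
  + lia.
  apply: (@steps_read _ _ _ _ _ _ _ 8 7 (addr v)) => //.
  + exact: mem_addr M _.
  + lia.
  apply: (@steps_read _ _ _ _ _ _ _ 9 8 0) => //.
  + by rewrite -[RHS]kv -(mem_count M).
  apply: (@steps_jump_eq _ _ _ _ _ _ _ 9 4 25) => //.
by split.
Qed.

(** Common prefix of skipping and entering, up to the comparison of the parent in register 7 with
    the neighbour in register 10. *)
Lemma run_take k out D rg mem v j :
  reg_inv v (size out) rg -> mem_inv k out D mem -> D v ->
  k v = j.+1 -> j < size (adj v) ->
  exists rg',
    [/\ run_steps 10 (State 10 rg mem) (State 20 rg' (upd mem (addr v) j)),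
        reg_inv v (size out) rg', rg' 7 = parent_word v
      & rg' 10 = nth r (adj v) j].
Proof.
move=> [R0 R1 R2 R3 R4 R5 R6] M Dv kv jv; eexists; split.
- have := ltn_ord v; have := addr_lt v => av vN.
  apply: (@steps_add _ _ _ _ _ _ _ 7 2 3 v.+1) => //.
  + by rewrite R2 R3 addn1.
  + lia.
  apply: (@steps_read _ _ _ _ _ _ _ 8 7 (addr v)) => //.
  + exact: mem_addr M _.
  + lia.
  apply: (@steps_read _ _ _ _ _ _ _ 9 8 j.+1) => //.
  + by rewrite -[RHS]kv -(mem_count M).
  + lia.
  apply: (@steps_jump_neq _ _ _ _ _ _ _ 9 4 25) => //.
  + by rewrite /upd /= R4.
  apply: (@steps_add _ _ _ _ _ _ _ 10 8 9 (addr v + j.+1)) => //.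
  + lia.
  apply: (@steps_read _ _ _ _ _ _ _ 10 10 (nth r (adj v) j)) => //.
  + exact: mem_adj M _ _ jv.
  + by have := ltn_ord (nth r (adj v) j); lia.
  apply: (@steps_sub _ _ _ _ _ _ _ 9 9 3 j) => //.
  + by rewrite /upd /= R3 subn1.
  + lia.
  apply: (@steps_write _ _ _ _ _ _ _ 8 9 (addr v) j) => //.
  apply: (@steps_add _ _ _ _ _ _ _ 7 6 2 (5 * N + v)) => //.
  + by rewrite /upd /= R6 R2.
  + lia.
  apply: (@steps_read _ _ _ _ _ _ _ 7 7 (parent_word v)) => //.
  + exact: mem_par (mem_inv_count v j M) _ Dv.
  + by rewrite /parent_word; case: ifP; have := ltn_ord (par v); lia.
- by split.
- by [].
- by [].
Qed.

Lemma run_skip k out D rg mem v j :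
  reg_inv v (size out) rg -> mem_inv k out D mem -> D v ->
  k v = j.+1 -> j < size (adj v) -> parent_word v = nth r (adj v) j ->
  exists rg' mem',
    [/\ run_steps 11 (State 10 rg mem) (State 10 rg' mem'),
        reg_inv v (size out) rg' & mem_inv [eta k with v |-> j] out D mem'].
Proof.
move=> R M Dv kv jv pv; have [rg' [st R' rg7 rg10]] := run_take R M Dv kv jv.
exists rg', (upd mem (addr v) j); split=> //; last exact: mem_inv_count.
rewrite -[11]/(10 + 1); apply: (steps_trans st).
apply: (@steps_jump_eq _ _ _ _ _ _ _ 7 10 10) => //; first by rewrite rg7 rg10.
Qed.

Lemma run_enter k out (D : pred 'I_N) rg mem v j :
  let w := nth r (adj v) j in
  reg_inv v (size out) rg -> mem_inv k out D mem -> D v ->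
  k v = j.+1 -> j < size (adj v) -> w \in children v ->
  exists rg' mem',
    [/\ run_steps 15 (State 10 rg mem) (State 7 rg' mem'),
        reg_inv w (size out) rg'
      & mem_inv [eta k with v |-> j] out [predU1 w & D] mem'].
Proof.
move=> w R M Dv kv jv w_v; have [rg' [st R' rg7 rg10]] := run_take R M Dv kv jv.
have wr := child_neq_root e_simple rooted neighbour_childrenE w_v.
have pw := child_par neighbour_childrenE w_v.
have evw : e v w by move: w_v; rewrite neighbour_childrenE => /andP[].
have pww : parent_word w = v by rewrite /parent_word (negPf wr) pw.
have := parent_wordE evw; rewrite pw eqxx => /eqP pvw.
case: R' => R0 R1 R2 R3 R4 R5 R6.
have wN := ltn_ord w.
do 2 eexists; split; first rewrite -[15]/(10 + 5).
- apply: (steps_trans st).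
  apply: (@steps_jump_neq _ _ _ _ _ _ _ 7 10 10) => //; first by rewrite rg7 rg10.
  apply: (@steps_add _ _ _ _ _ _ _ 7 6 10 (5 * N + w)) => //.
  + by rewrite R6 rg10.
  + lia.
  apply: (@steps_write _ _ _ _ _ _ _ 7 2 (5 * N + w) v) => //.
  (* The IJump that follows is executed by conversion, when [=> //] unifies
     the remaining goal with reflexivity of [steps]. *)
  apply: (@steps_move _ _ _ _ _ _ _ 2 10 w) => //.
  + lia.
- by split.
by rewrite -pww; apply/mem_inv_par/mem_inv_count.
Qed.

Lemma run_return k out (D : pred 'I_N) rg mem v w :
  reg_inv w (size out) rg -> mem_inv k out D mem -> D w ->
  w \in children v ->
  exists rg', run_steps 5 (State 25 rg mem) (State 7 rg' mem) /\
    reg_inv v (size out) rg'.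
Proof.
move=> [R0 R1 R2 R3 R4 R5 R6] M Dw w_v.
have wr := child_neq_root e_simple rooted neighbour_childrenE w_v.
have pw := child_par neighbour_childrenE w_v.
have pww : parent_word w = v by rewrite /parent_word (negPf wr) pw.
have vN := ltn_ord v; have wN := ltn_ord w.
eexists; split.
  apply: (@steps_add _ _ _ _ _ _ _ 7 6 2 (5 * N + w)) => //.
  + by rewrite R6 R2.
  + lia.
  apply: (@steps_read _ _ _ _ _ _ _ 7 7 v) => //.
  + by rewrite /upd /= (mem_par M).
  + lia.
  apply: (@steps_jump_neq _ _ _ _ _ _ _ 7 5 30) => //.
  + by rewrite /upd /= R5; lia.
  apply: (@steps_move _ _ _ _ _ _ _ 2 7 v) => //.
  + lia.
by split.
Qed.

(* A child w of v causes two output entries and at most 41 steps besides its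
   own children: 15 to enter it, 3 to output w, 11 to skip v in its list, 4 to
   exhaust the list, 5 to return and 3 to output v; hence 21 per entry. *)
Definition dfs_ok (n : nat) (v : 'I_N) : Prop :=
  forall k out (D : pred 'I_N) rg mem,
  D v -> (forall u, u \in tour n v -> k u = size (adj u)) ->
  size out + size (behead (tour n v)) <= 2 * N ->
  reg_inv v (size out) rg -> mem_inv k out D mem ->
  exists t rg' mem' k',
    [/\ t <= 15 + 21 * size (behead (tour n v)),
        run_steps t (State 10 rg mem) (State 25 rg' mem'),
        reg_inv v (size (out ++ behead (tour n v))) rg',
        mem_inv k' (out ++ behead (tour n v)) D mem'
      & forall u, u \notin tour n v -> k' u = k u].

(** Only the parent can be skipped, so each list costs at most one skip. *)
Lemma count_non_children v : count (fun w => par w != v) (adj v) <= 1.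
Proof.
have [adj_uniq adjE] := adjP v.
rewrite -size_filter -[1]/(size [:: par v]); apply: uniq_leq_size.
  exact: filter_uniq.
move=> w; rewrite mem_filter inE adjE => /andP[pw evw].
by case: (edge_par rooted evw) => [->|/eqP]; rewrite ?eqxx // (negPf pw).
Qed.

Lemma size_adj_children v : size (adj v) <= (size (children v)).+1.
Proof.
rewrite size_rev size_filter -(count_predC (fun w => par w == v) (adj v)).
by rewrite -addn1 leq_add2l count_non_children.
Qed.

(** Induction on the number [j] of neighbours left. Unvisited subtrees must still have full
    counters, which is why the conclusion also says what stays unchanged. *)
Lemma scan_children n v :
  (forall w, w \in children v -> dfs_ok n w) ->
  forall j k out (D : pred 'I_N) rg mem,
  let ws := rev [seq w <- take j (adj v) | par w == v] in
  let p := flatten [seq rcons (tour n w) v | w <- ws] in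
  D v -> j <= size (adj v) -> k v = j ->
  (forall w u, w \in ws -> u \in tour n w -> k u = size (adj u)) ->
  size out + size p <= 2 * N ->
  reg_inv v (size out) rg -> mem_inv k out D mem ->
  exists t rg' mem' k',
    [/\ t <= 4 + 11 * count (fun w => par w != v) (take j (adj v)) + 21 * size p,
        run_steps t (State 10 rg mem) (State 25 rg' mem'),
        reg_inv v (size (out ++ p)) rg',
        mem_inv k' (out ++ p) D mem'
      & forall u, u != v -> (forall w, w \in ws -> u \notin tour n w) ->
        k' u = k u].
Proof.
move=> IHn; elim=> [|j IHj] k out D rg mem.
  rewrite take0 /= => Dv _ kv _ _ R M.
  have [rg' [st R']] := run_exhausted R M kv.
  by exists 4, rg', mem, k; rewrite cats0; split.
move=> ws p Dv jv kv full; move: @ws @p full.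
rewrite (take_nth r jv) filter_rcons -[rcons (take _ _) _]cats1 count_cat /= addn0.
set w := nth r (adj v) j; set ws' := [seq w <- take j (adj v) | par w == v].
have evw : e v w by rewrite -(adjP v).2 mem_nth.
case: ifP => pw.
  have w_v : w \in children v by rewrite neighbour_childrenE evw pw.
  rewrite rev_rcons /= size_cat size_rcons => full out_le R M.
  have ws'_v x : x \in rev ws' -> x \in children v.
    rewrite !mem_rev mem_filter => /andP[px /mem_take xv].
    by rewrite mem_filter px.
  have w_ws' : w \notin rev ws'.
    rewrite mem_rev mem_filter negb_and; apply/orP; right.
    have := take_uniq j.+1 (adjP v).1.
    by rewrite (take_nth r jv) rcons_uniq => /andP[].
  have v_w := parent_notin_tour e_simple rooted neighbour_childrenE n w_v.
  have [rg1 [mem1 [st1 R1 M1]]] := run_enter R M Dv kv jv w_v.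
  have [|rg2 [mem2 [st2 R2 M2]]] := run_emit _ R1 M1; first lia.
  have sz_tour : size (tour n w) = (size (behead (tour n w))).+1.
    by rewrite {1}tour_cons.
  have [|u u_w||t [rg3 [mem3 [k3 [t_le st3 R3 M3 k3E]]]]] :=
    IHn w w_v _ _ [predU1 w & D] rg2 mem2 _ _ _ R2 M2.
  - by rewrite /= eqxx.
  - rewrite /=; case: (eqVneq u v) => [uv|_].
      by rewrite uv (negPf v_w) in u_w.
    by apply: full u_w; rewrite mem_head.
  - by move: sz_tour out_le; rewrite size_rcons /=; lia.
  have [|rg4 [st4 R4]] := run_return R3 M3 _ w_v; first by rewrite /= eqxx.
  (* [D] only needs to cover the branch being explored, so [w] is dropped from it on return. *)
  have {}M3 : mem_inv k3 (rcons out w ++ behead (tour n w)) D mem3.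
    by apply: mem_inv_sub M3 => u Du; apply/orP; right.
  have [|rg5 [mem5 [st5 R5 M5]]] := run_emit _ R4 M3.
    by move: sz_tour out_le; rewrite size_cat size_rcons /=; lia.
  have k3v : k3 v = j by rewrite k3E //= eqxx.
  have [x u x_ws' u_x||t' [rg6 [mem6 [k6 [t'_le st6 R6 M6 k6E]]]]] :=
    IHj _ _ _ _ _ Dv (ltnW jv) k3v _ _ R5 M5.
  (* Subtrees of the remaining siblings contain neither [v] nor anything below [w], so their
     counters are still full. *)
  - have x_v := ws'_v x x_ws'.
    have uv : u != v.
      apply: contraTneq u_x => ->.
      exact: (parent_notin_tour e_simple rooted neighbour_childrenE).
    rewrite k3E /= ?(negPf uv); first by apply: full u_x; rewrite inE x_ws' orbT.
    apply: contraNN w_ws' => u_w.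
    by rewrite (tour_siblings_disjoint e_simple rooted neighbour_childrenE
      w_v x_v u_w u_x).
  - by move: sz_tour out_le; rewrite /ws' size_rcons size_cat size_rcons /=; lia.
  (* In order: enter [w], output it, search below it, return, output [v], scan the remaining
     neighbours. *)
  exists (15 + 3 + t + 5 + 3 + t'), rg6, mem6, k6.
  have Dout : rcons (rcons out w ++ behead (tour n w)) v =
      out ++ rcons (tour n w) v.
    by rewrite {2}(tour_cons children n w) -!cats1 -!catA.
  rewrite Dout -catA in R6 M6; split => //.
  - by move: sz_tour t_le t'_le; rewrite /ws' /=; lia.
  - exact: steps_trans (steps_trans (steps_trans
      (steps_trans (steps_trans st1 st2) st3) st4) st5) st6.
  move=> u uv u_ws; rewrite k6E // => [|x x_ws'].
    by rewrite k3E /= ?(negPf uv) // u_ws ?mem_head.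
  by rewrite u_ws // inE x_ws' orbT.
(* Here [w] is the parent of [v]: it is skipped, and the list of children is unchanged. *)
move=> full out_le R M.
have pvw : parent_word v = w by apply/eqP; rewrite (parent_wordE evw) pw.
have [rg1 [mem1 [st1 R1 M1]]] := run_skip R M Dv kv jv pvw.
have [||t [rg2 [mem2 [k2 [t_le st2 R2 M2 k2E]]]]] :=
  IHj _ _ _ _ _ Dv (ltnW jv) _ _ out_le R1 M1.
- by rewrite /= eqxx.
- move=> x u x_ws u_x /=; rewrite ifN; first exact: full u_x.
  apply: contraTneq u_x => ->.
  apply: (parent_notin_tour e_simple rooted neighbour_childrenE).
  by move: x_ws; rewrite !mem_rev !mem_filter => /andP[-> /mem_take].
exists (11 + t), rg2, mem2, k2; split=> //; first by move: t_le; rewrite /ws' /=; lia.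
  exact: steps_trans st1 st2.
by move=> u uv u_ws; rewrite k2E //= (negPf uv).
Qed.

Lemma tour_scan n k out (D : pred 'I_N) rg mem v :
  (forall w, w \in children v -> dfs_ok n w) ->
  D v -> (forall u, u \in tour n.+1 v -> k u = size (adj u)) ->
  size out + size (behead (tour n.+1 v)) <= 2 * N ->
  reg_inv v (size out) rg -> mem_inv k out D mem ->
  exists t rg' mem' k',
    [/\ t <= 15 + 21 * size (behead (tour n.+1 v)),
        run_steps t (State 10 rg mem) (State 25 rg' mem'),
        reg_inv v (size (out ++ behead (tour n.+1 v))) rg',
        mem_inv k' (out ++ behead (tour n.+1 v)) D mem'
      & forall u, u \notin tour n.+1 v -> k' u = k u].
Proof.
move=> IHn Dv full out_le R M.
have kv : k v = size (adj v) by apply: full; rewrite tourS mem_head.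
have := scan_children IHn Dv (leqnn _) kv _ _ R M; rewrite take_size.
case=> [w u w_v u_w||t [rg' [mem' [k' [t_le st R' M' k'E]]]]].
- apply: full; rewrite tourS inE; apply/orP; right.
  by apply/flatten_mapP; exists w; rewrite // mem_rcons inE u_w orbT.
- exact: out_le.
exists t, rg', mem', k'; split=> // [|u].
  (* The 15 is 4 for the exhausted list plus 11 for at most one skip. *)
  by move: t_le (count_non_children v); rewrite tourS /neighbour_children /=; lia.
rewrite tourS inE negb_or => /andP[uv u_v]; apply: k'E => // w w_v.
apply: contraNN u_v => u_w; apply/flatten_mapP; exists w => //.
by rewrite mem_rcons inE u_w orbT.
Qed.

Lemma dfs_correct n v : (forall u, dep u <= dep v + n) -> dfs_ok n v.
Proof.
elim: n v => [|n IHn] v dep_v; last first.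
  move=> k out D rg mem; apply: tour_scan => w w_v; apply: IHn => u.
  by rewrite (child_dep e_simple rooted neighbour_childrenE w_v) addSnnS.
have no_child w : w \notin children v.
  apply/negP => w_v; have := dep_v w.
  by rewrite (child_dep e_simple rooted neighbour_childrenE w_v) addn0 ltnn.
(* Without children both fuels give the same tour, so [tour_scan] covers this case too. *)
have tour01 : tour 0 v = tour 1 v.
  by rewrite tourS; case: (children v) no_child => // w s /(_ w); rewrite mem_head.
rewrite /dfs_ok tour01 => k out D rg mem; apply: tour_scan => w w_v.
by rewrite (negPf (no_child w)) in w_v.
Qed.

Hypothesis root0 : r = 0 :> nat.
Hypothesis N_ge2 : 1 < N.

Lemma run_dfs_program n mem :
  (forall u, dep u <= dep r + n) -> mem 0 = N ->
  mem_inv (fun u => size (adj u)) [::] pred0 mem ->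
  exists st,
    run dfs_program W (60 * N) (State 0 (fun=> 0) mem) = Some st /\
    output st = map val (take (size (tour n r)).-1 (tour n r)).
Proof.
move=> dep_n mem_N M.
(* The first write marks the root: its parent cell is [5 * N], as [r] is 0. *)
have := mem_inv_par r M; rewrite /parent_word eqxx root0 addn0 => M1.
set mem1 := upd mem (5 * N) N in M1.
have [rg1 [st1 R1]] : exists rg1,
    run_steps 7 (State 0 (fun=> 0) mem) (State 7 rg1 mem1) /\ reg_inv r 0 rg1.
  eexists; split.
    apply: (@steps_read _ _ _ _ _ _ _ 5 4 N) => //; first lia.
    apply: (@steps_const _ _ _ _ _ _ _ 3 1) => //; first lia.
    apply: (@steps_add _ _ _ _ _ _ _ 6 5 5 (2 * N)) => //.
    - by rewrite /upd /=; lia.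
    - lia.
    apply: (@steps_add _ _ _ _ _ _ _ 6 6 6 (4 * N)) => //.
    - by rewrite /upd /=; lia.
    - lia.
    apply: (@steps_add _ _ _ _ _ _ _ 6 6 5 (5 * N)) => //.
    - by rewrite /upd /=; lia.
    - lia.
    apply: (@steps_add _ _ _ _ _ _ _ 0 6 5 (6 * N)) => //.
    - by rewrite /upd /=; lia.
    - lia.
  by split; rewrite /upd /= ?root0.
have sz_tour : size (tour n r) = (size (behead (tour n r))).+1.
  by rewrite {1}tour_cons.
have tour_le := size_tour e_simple rooted neighbour_children_uniq
  neighbour_childrenE n r; rewrite card_ord in tour_le.
have [rg2 [mem2 [st2 R2 M2]]] := run_emit (v := r) (out := [::]) isT R1 M1.
have [|||t [rg3 [mem3 [k3 [t_le st3 R3 M3 _]]]]] :=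
  dfs_correct dep_n _ _ _ R2 M2.
- by rewrite /= eqxx.
- by [].
- by move: sz_tour tour_le => /=; lia.
rewrite /= -tour_cons in R3 M3.
have [rg4 [st4 R4_0 R4_1]] : exists rg4,
    [/\ run_steps 4 (State 25 rg3 mem3) (State 31 rg4 mem3),
        rg4 0 = 6 * N & rg4 1 = (size (tour n r)).-1].
  case: R3 => R0 R1' R2' R3' R4 R5 R6; eexists; split.
  - apply: (@steps_add _ _ _ _ _ _ _ 7 6 2 (5 * N + r)) => //.
    + by rewrite R6 R2'.
    + lia.
    apply: (@steps_read _ _ _ _ _ _ _ 7 7 N) => //.
    + by rewrite /upd /= (mem_par M3) /= ?eqxx // /parent_word eqxx.
    + lia.
    apply: (@steps_jump_eq _ _ _ _ _ _ _ 7 5 30) => //.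
    apply: (@steps_sub _ _ _ _ _ _ _ 1 1 3 (size (tour n r)).-1) => //.
    + by rewrite /upd /= R1' R3' subn1 sz_tour.
    + by apply: leq_trans (leq_trans (leq_pred _) tour_le) _; lia.
  - by [].
  - by [].
exists (State 31 rg4 mem3); split.
  (* There are 14 steps outside the search and at most 15 + 21(2N - 1) in it, hence at most 42N +
     8. *)
  have -> : 60 * N = 7 + 3 + t + 4 + (60 * N - (14 + t)).
    by move: sz_tour tour_le t_le => /=; lia.
  rewrite (steps_trans (steps_trans (steps_trans st1 st2) st3) st4).
  (* At [IHalt] any remaining fuel gives the same state; the case split only lets [run] unfold. *)
  by case: (_ - _).
rewrite /output /= R4_0 R4_1.
have lt_sz : (size (tour n r)).-1 < size (tour n r) by rewrite sz_tour.
apply: (@eq_from_nth _ 0) => [|i].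
  by rewrite !size_map size_iota size_take lt_sz.
rewrite size_map size_iota => i_lt; have i_tour := ltn_trans i_lt lt_sz.
rewrite (nth_map 0) ?size_iota // nth_iota // add0n (mem_out M3) //.
by rewrite (nth_map r) ?nth_take // size_take lt_sz.
Qed.

End Dfs.

(** * Memory layout of the encoded adjacency lists *)

Lemma nth_flatten_block (T : Type) (x0 : T) (ss : seq (seq T)) v i :
  v < size ss -> i < size (nth [::] ss v) ->
  nth x0 (flatten ss) (sumn (shape (take v ss)) + i) = nth x0 (nth [::] ss v) i.
Proof.
elim: ss v => [|s ss IHss] [|v] //= v_ss i_v; rewrite nth_cat; first by rewrite i_v.
by rewrite -addnA ltnNge leq_addr /= addKn IHss.
Qed.

Lemma sumn_shape_take (T : Type) (ss : seq (seq T)) u w :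
  u < w -> w <= size ss ->
  sumn (shape (take u ss)) + size (nth [::] ss u) <= sumn (shape (take w ss)).
Proof.
elim: ss u w => [|s ss IHss] [|u] [|w] //= uw w_ss; first by rewrite leq_addr.
by rewrite -addnA leq_add2l IHss.
Qed.

Section Layout.

Variables (N : nat) (adj : 'I_N -> seq 'I_N).

Definition adj_blocks : seq (seq nat) :=
  [seq size l :: l | l <- [seq map val (adj v) | v <- enum 'I_N]].

Definition block_addr (v : nat) : nat := N.+1 + sumn (shape (take v adj_blocks)).

Lemma size_adj_blocks : size adj_blocks = N.
Proof. by rewrite /adj_blocks 2!size_map size_enum_ord. Qed.

Lemma nth_adj_blocks (v : 'I_N) :
  nth [::] adj_blocks v = size (adj v) :: map val (adj v).
Proof.
rewrite (nth_map [::]); last by rewrite size_map size_enum_ord.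
by rewrite (nth_map v) ?size_enum_ord // nth_ord_enum size_map.
Qed.

Lemma encode_adjE :
  encode_adj adj =
  N :: [seq block_addr v | v <- iota 0 N] ++ flatten adj_blocks.
Proof. by rewrite /encode_adj /encode_lists size_map size_enum_ord. Qed.

Lemma nth_encode_addr (v : 'I_N) : nth 0 (encode_adj adj) v.+1 = block_addr v.
Proof.
rewrite encode_adjE /= nth_cat size_map size_iota ltn_ord.
by rewrite (nth_map 0) ?size_iota // nth_iota.
Qed.

Lemma nth_encode_block (v : 'I_N) i :
  i <= size (adj v) ->
  nth 0 (encode_adj adj) (block_addr v + i) =
  nth 0 (size (adj v) :: map val (adj v)) i.
Proof.
move=> i_v; rewrite encode_adjE /block_addr addSn addSn /= nth_cat size_map size_iota.
rewrite -addnA ltnNge leq_addr /= addKn nth_flatten_block ?nth_adj_blocks //.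
  by rewrite size_adj_blocks.
by rewrite /= size_map.
Qed.

Lemma block_addr_lt (u w : 'I_N) :
  u < w -> block_addr u + size (adj u) < block_addr w.
Proof.
move=> uw; have := @sumn_shape_take _ adj_blocks u w uw.
rewrite size_adj_blocks nth_adj_blocks /= size_map /block_addr.
move=> /(_ (ltnW (ltn_ord w))).
lia.
Qed.

(** Size and address table take [N + 1] cells, block lengths [N] more. With degree sum at most
    [2 * N], the input stays below [5 * N]. *)
Lemma block_addr_bound (v : 'I_N) :
  block_addr v + size (adj v) <= 2 * N + \sum_u size (adj u).
Proof.
have := @sumn_shape_take _ adj_blocks v N (ltn_ord v).
rewrite size_adj_blocks nth_adj_blocks /= size_map /block_addr => /(_ (leqnn _)).
rewrite [take N _]take_oversize ?size_adj_blocks //.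
suff -> : sumn (shape adj_blocks) = N + \sum_u size (adj u).
  by rewrite /= /shape; lia.
rewrite /adj_blocks /shape sumnE 3!big_map big_enum /=.
under eq_bigr => u _ do rewrite size_map -add1n.
by rewrite big_split /= sum1_card card_ord.
Qed.

End Layout.

(** * The linear-time algorithm on encoded trees *)

Lemma dfs_program_computes (N : nat) (e : rel 'I_N) (adj : 'I_N -> seq 'I_N) :
  is_tree e -> 1 < N -> adjacency_lists e adj ->
  exists s, is_UHC e #|nonleaves e| s /\
    computes dfs_program (60 * N) (60 * N) (encode_adj adj) (map val s).
Proof.
move=> tree N2 adjP; have [simple _ conn acyclic] := tree.
have N_gt0 : 0 < N by exact: ltnW.
pose r : 'I_N := Ordinal N_gt0.
have [par [dep rooted]] := tree_rooting r tree.
pose n := \max_u dep u.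
have dep_n u : dep u <= dep r + n.
  by apply: leq_trans (leq_addl _ _); apply: (leq_bigmax u).
have ch_uniq := neighbour_children_uniq par adjP.
have chE := neighbour_childrenE par adjP.
have V2 : 1 < #|'I_N| by rewrite card_ord.
have [UHC_s _] := open_tour_UHC simple rooted ch_uniq chE conn acyclic V2 dep_n.
eexists; split; first exact: UHC_s.
(* Each vertex has at most one neighbour besides its children, and there are at most [N] children in
   all. *)
have sum_adj : \sum_u size (adj u) <= 2 * N.
  rewrite (@leq_trans (\sum_u (1 + size (neighbour_children adj par u)))) //.
    by apply: leq_sum => u _; apply: (size_adj_children rooted adjP).
  rewrite big_split /= sum1_card card_ord mul2n -addnn leq_add2l.
  by have := sum_children ch_uniq chE; rewrite card_ord.
have [||||||st [run_st out_st]] := @run_dfs_program N e adj r par dep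
  (block_addr adj) (60 * N) simple rooted adjP _ _ _ _ erefl N2 n
  (nth 0 (encode_adj adj)) dep_n.
- by move=> u; rewrite /block_addr; lia.
- by move=> u; have := block_addr_bound adj u; lia.
- move=> u w i uw i_w.
  have := @block_addr_lt N adj u w; have := @block_addr_lt N adj w u.
  by rewrite -val_eqE /= in uw; lia.
- by lia.
- by rewrite encode_adjE.
- split => //.
  + exact: nth_encode_addr.
  + by move=> u; have := @nth_encode_block N adj u 0 isT; rewrite addn0.
  + by move=> u i i_u; rewrite nth_encode_block //= (nth_map r).
by rewrite /computes /init_state run_st /= out_st.
Qed.

Theorem mainTheorem3 :
  (forall (V : finType) (e : rel V),
     is_tree e -> 2 <= #|V| ->
     exists m : nat,
       [/\ is_min_UHC e m,
           m = #|nonleaves e|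
         & exists s : seq V, is_UHC e m s /\ unbounded s = nonleaves e])
  /\
  (exists (P : program) (c : nat),
     forall (N : nat) (e : rel 'I_N) (adj : 'I_N -> seq 'I_N) (m : nat),
       is_tree e -> 2 <= N -> adjacency_lists e adj -> is_min_UHC e m ->
       exists s : seq 'I_N,
         is_UHC e m s /\
         computes P (c * N) (c * N) (encode_adj adj) (map val s)).
Proof.
split=> [V e tree V2|].
  by have [min_m ex_s] := tree_min_UHC tree V2; exists #|nonleaves e|.
(* The constant serves twice: it exceeds the 42N + 8 steps needed, and as word bound it exceeds
   [8 * N]. *)
exists dfs_program, 60 => N e adj m tree N2 adjP min_m.
have V2 : 1 < #|'I_N| by rewrite card_ord.
have [min_nonleaves _] := tree_min_UHC tree V2.
rewrite (min_UHC_unique min_m min_nonleaves).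
exact: dfs_program_computes.
Qed.
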